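(* Let $p\ge1$ be an integer and let $f(z)=\sum_{j=1}^{p}\big(a_jz^j+\overline{b_j}\,\overline z^{j}\big)$, with $a_j,b_j\in\mathbb{C}$, be a harmonic mapping in the unit disk $\mathbb{D}$ with $f(\mathbb{D})\subset\mathbb{D}$. Then for all $z,w\in\mathbb{D}$ with $z\ne w$, $$j_{\mathbb{D}}(f(z),f(w))<\frac{p\sqrt{2p}}{2}\,\pi\, j_{\mathbb{D}}(z,w).$$
   Context: $\mathbb{D}=\{z\in\mathbb{C}:|z|<1\}$. For a proper subdomain $G\subset\mathbb{C}$ and $z,w\in G$, the distance ratio metric is $$j_G(z,w)=\log\left(1+\frac{|z-w|}{\min\{d(z,\partial G),d(w,\partial G)\}}\right),$$ where $d(z,\partial G)$ is the Euclidean distance from $z$ to $\partial G$. *)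

(* Defs.v *)
(* Stdlib world: concrete reals R, Coquelicot's complex numbers C. *)
From Stdlib Require Export Reals.
From Coquelicot Require Export Coquelicot.
Open Scope R_scope.

Definition unit_disk (z : C) : Prop := Cmod z < 1.

(* Closure minus interior; [~ locally z (fun w => ~ G w)] is adherence to G,
   as in Coquelicot's definition of [closed]. *)
Definition boundary {T : UniformSpace} (G : T -> Prop) (z : T) : Prop :=
  ~ locally z (fun w => ~ G w) /\ ~ locally z G.

(* [Cmod] is the Euclidean norm. The infimum is finite as soon as the boundary
   is nonempty, which holds for every nonempty G different from C. *)
Definition dist_boundary (G : C -> Prop) (z : C) : R :=
  real (Glb_Rbar (fun r => exists w : C, boundary G w /\ r = Cmod (z - w)%C)).

(* Meaningful when G is a proper subdomain of C and z, w lie in G. *)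
Definition j_metric (G : C -> Prop) (z w : C) : R :=
  ln (1 + Cmod (z - w)%C / Rmin (dist_boundary G z) (dist_boundary G w)).

(* Intended for open G: [ex_diff_n u 2] at every point of G says that u and all
   its partial derivatives of order at most 2 exist and are continuous on G. *)
Definition real_harmonic_on (G : C -> Prop) (u : R -> R -> R) : Prop :=
  forall x y : R, G (x, y) ->
    ex_diff_n u 2 x y /\
    partial_derive 2 0 u x y + partial_derive 0 2 u x y = 0.

Definition harmonic_mapping_on (G : C -> Prop) (f : C -> C) : Prop :=
  real_harmonic_on G (fun x y => Re (f (x, y))) /\
  real_harmonic_on G (fun x y => Im (f (x, y))).

(* Main.v *)
Require Import Defs.
From Stdlib Require Import Lra Lia Psatz.

(** On the unit disk [d(z, boundary) = 1 - |z|], so the claim compares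
    [|f z - f w|] with [|z - w|] and [1 - |f z|] with [1 - |z|].

    Numerator: [f] is a harmonic polynomial bounded by 1, also on the unit
    circle. Integrating [|f|^2] over the circle gives Bessel's inequality
    [sum (|a_j|^2 + |b_j|^2) <= 1] ([harmonic_poly_bessel]). Since
    [|z^j - w^j| <= j |z - w|], the map [f] is Lipschitz with constant
    [sum j (|a_j| + |b_j|) <= p sum (|a_j| + |b_j|) <= p sqrt (2 p)], the last
    step being the Cauchy-Schwarz inequality for [2 p] numbers
    ([harmonic_poly_lipschitz], [harmonic_lipschitz_constant_le]).

    Denominator: [f 0 = 0], so the harmonic Schwarz lemma gives
    [|f z| <= (4 / PI) atan |z|]. As [atan] lies below its tangent at 1, this
    yields [1 - |f z| >= (2 / PI) (1 - |z|)] ([harmonic_poly_schwarz]). The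
    Schwarz lemma is proved with the Poisson kernel: averaging [f] over the two
    points of the circle that are symmetric about the ray through [z] leaves a
    cosine polynomial [T], and the integral of [poisson_kernel r * T] over
    [[0, PI]] is [PI] times the value of [f] at radius [r] on the ray. As [T] has mean 0, a constant may be
    subtracted from the kernel; choosing it to make the kernel change sign at
    [PI / 2] gives the sharp bound ([cosine_polynomial_schwarz]).

    Hence the quotient inside the logarithm grows at most by the factor
    [c = p sqrt (2 p) PI / 2 > 1], and the strict inequality comes from
    [ln (1 + c x) < c ln (1 + x)] for [x > 0] ([ln_strict_bernoulli]). *)

(** * Finite sums and integrals *)

(** The type of a real [sum_n_m] is the carrier of an abelian monoid, which
    [ring] does not recognise as [R]. *)
Ltac real_ring :=
  match goal with |- ?u = ?v => change (@eq R u v) end; ring.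

Lemma Rsum_0 (u : nat -> R) : sum_n_m u 1 0 = 0.
Proof. apply (sum_n_m_zero u 1 0). lia. Qed.

Lemma Rsum_S (u : nat -> R) (p : nat) :
  sum_n_m u 1 (S p) = sum_n_m u 1 p + u (S p).
Proof. apply (sum_n_Sm u 1 p). lia. Qed.

Lemma Rsum_scal_l (c : R) (u : nat -> R) (p : nat) :
  sum_n_m (fun j => c * u j) 1 p = c * sum_n_m u 1 p.
Proof. exact (sum_n_m_mult_l (K := R_Ring) c u 1 p). Qed.

Lemma Rsum_ext (p : nat) (u v : nat -> R) :
  (forall j, (1 <= j <= p)%nat -> u j = v j) -> sum_n_m u 1 p = sum_n_m v 1 p.
Proof. intros H. apply sum_n_m_ext_loc. exact H. Qed.

Lemma Csum_0 (u : nat -> C) : sum_n_m u 1 0 = RtoC 0.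
Proof. apply (sum_n_m_zero u 1 0). lia. Qed.

Lemma Csum_S (u : nat -> C) (p : nat) :
  sum_n_m u 1 (S p) = (sum_n_m u 1 p + u (S p))%C.
Proof. apply (sum_n_Sm u 1 p). lia. Qed.

Lemma is_RInt_const_R (c a b : R) : is_RInt (fun _ => c) a b ((b - a) * c).
Proof. exact (@is_RInt_const R_NormedModule a b c). Qed.

Lemma is_RInt_eq (g h : R -> R) (a b l m : R) :
  is_RInt g a b l -> (forall t, g t = h t) -> l = m -> is_RInt h a b m.
Proof.
  intros Hg Hgh <-. revert Hg. apply is_RInt_ext. intros t _. apply Hgh.
Qed.

Lemma is_RInt_sum (p : nat) (g : nat -> R -> R) (l : nat -> R) (a b : R) :
  (forall j, (1 <= j <= p)%nat -> is_RInt (g j) a b (l j)) ->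
  is_RInt (fun t => sum_n_m (fun j => g j t) 1 p) a b (sum_n_m l 1 p).
Proof.
  induction p as [|p IH]; intros H.
  - rewrite Rsum_0.
    apply (is_RInt_ext (fun _ => 0)).
    { intros x _. now rewrite Rsum_0. }
    pose proof (is_RInt_const_R 0 a b) as H0. rewrite Rmult_0_r in H0. exact H0.
  - rewrite Rsum_S.
    apply (is_RInt_ext (fun t => plus (sum_n_m (fun j => g j t) 1 p) (g (S p) t))).
    { intros x _. now rewrite Rsum_S. }
    apply (@is_RInt_plus R_NormedModule).
    + apply IH. intros j Hj. apply H. lia.
    + apply H. lia.
Qed.

(** * Orthogonality of cosines and sines on a half period *)

Lemma sin_nat_PI (n : nat) : sin (INR n * PI) = 0.
Proof. apply sin_eq_0_1. exists (Z.of_nat n). now rewrite <- INR_IZR_INZ. Qed.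

Lemma is_RInt_cos_nat (n : nat) : (1 <= n)%nat ->
  is_RInt (fun t => cos (INR n * t)) 0 PI 0.
Proof.
  intros Hn.
  assert (Hn' : INR n <> 0) by (apply not_0_INR; lia).
  replace 0 with (minus (sin (INR n * PI) / INR n) (sin (INR n * 0) / INR n)) at 2.
  2:{ unfold minus, plus, opp; simpl. rewrite sin_nat_PI, Rmult_0_r, sin_0.
      field. exact Hn'. }
  apply (is_RInt_derive (V := R_CompleteNormedModule) (fun t => sin (INR n * t) / INR n)).
  - intros x _. auto_derive; [easy|]. field. exact Hn'.
  - intros x _. apply (ex_derive_continuous (fun t => cos (INR n * t))). auto_derive. easy.
Qed.

Lemma is_RInt_one : is_RInt (fun _ => 1) 0 PI PI.
Proof.
  replace PI with ((PI - 0) * 1) at 2 by ring. apply is_RInt_const_R.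
Qed.

Lemma is_RInt_lin2 (g h : R -> R) (a b lg lh c d : R) :
  is_RInt g a b lg -> is_RInt h a b lh ->
  is_RInt (fun t => c * g t + d * h t) a b (c * lg + d * lh).
Proof.
  intros Hg Hh.
  apply (@is_RInt_plus R_NormedModule).
  - now apply (@is_RInt_scal R_NormedModule).
  - now apply (@is_RInt_scal R_NormedModule).
Qed.

Lemma trig_orthogonality (j k : nat) : (1 <= j)%nat -> (1 <= k)%nat ->
  is_RInt (fun t => cos (INR j * t) * cos (INR k * t)) 0 PI
    (if Nat.eq_dec j k then PI / 2 else 0) /\
  is_RInt (fun t => sin (INR j * t) * sin (INR k * t)) 0 PI
    (if Nat.eq_dec j k then PI / 2 else 0).
Proof.
  intros Hj Hk.
  assert (Hs : is_RInt (fun t => cos (INR j * t + INR k * t)) 0 PI 0).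
  { apply (is_RInt_ext (fun t => cos (INR (j + k) * t))).
    { intros t _. rewrite plus_INR. f_equal. ring. }
    apply is_RInt_cos_nat. lia. }
  assert (Hd : is_RInt (fun t => cos (INR j * t - INR k * t)) 0 PI
                 (if Nat.eq_dec j k then PI else 0)).
  { destruct (Nat.eq_dec j k) as [->|Hne].
    - apply (is_RInt_ext (fun _ => 1)); [|exact is_RInt_one].
      intros t _. now rewrite Rminus_diag, cos_0.
    - destruct (Nat.lt_total j k) as [Hlt|[Heq|Hlt]]; [|contradiction|].
      + apply (is_RInt_ext (fun t => cos (INR (k - j) * t))).
        { intros t _. rewrite minus_INR by lia. rewrite <- cos_neg. f_equal. ring. }
        apply is_RInt_cos_nat. lia.
      + apply (is_RInt_ext (fun t => cos (INR (j - k) * t))).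
        { intros t _. rewrite minus_INR by lia. f_equal. ring. }
        apply is_RInt_cos_nat. lia. }
  split.
  - apply (is_RInt_eq _ _ _ _ _ _ (is_RInt_lin2 _ _ _ _ _ _ (1/2) (1/2) Hd Hs)).
    + intros t. rewrite cos_minus, cos_plus. field.
    + destruct (Nat.eq_dec j k); field.
  - apply (is_RInt_eq _ _ _ _ _ _ (is_RInt_lin2 _ _ _ _ _ _ (1/2) (-(1/2)) Hd Hs)).
    + intros t. rewrite cos_minus, cos_plus. field.
    + destruct (Nat.eq_dec j k); field.
Qed.

Lemma sum_kronecker (p k : nat) (x : nat -> R) (c : R) : (1 <= k <= p)%nat ->
  sum_n_m (fun j => x j * (if Nat.eq_dec k j then c else 0)) 1 p = x k * c.
Proof.
  assert (H0 : forall q, (q < k)%nat ->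
    sum_n_m (fun j => x j * (if Nat.eq_dec k j then c else 0)) 1 q = 0).
  { induction q as [|q IH]; intros Hq; [apply Rsum_0|].
    rewrite Rsum_S, IH by lia.
    destruct (Nat.eq_dec k (S q)) as [E|_]; [exfalso; lia|real_ring]. }
  induction p as [|p IH]; intros Hk; [lia|].
  rewrite Rsum_S. destruct (Nat.eq_dec k (S p)) as [->|Hne].
  - rewrite H0 by lia. real_ring.
  - rewrite IH by lia. real_ring.
Qed.

(** Expanding the square gives a double sum of which the integral keeps only
    the diagonal. A general orthogonal family serves cosines and sines alike. *)
Lemma parseval (p : nat) (phi : nat -> R -> R) (c : R) (x : nat -> R) :
  (forall j k, (1 <= j)%nat -> (1 <= k)%nat ->
     is_RInt (fun t => phi j t * phi k t) 0 PI (if Nat.eq_dec j k then c else 0)) ->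
  is_RInt (fun t => (sum_n_m (fun j => x j * phi j t) 1 p) ^ 2) 0 PI
    (c * sum_n_m (fun j => x j ^ 2) 1 p).
Proof.
  intros Horth.
  assert (Hsq : forall t,
    sum_n_m (fun k => x k * sum_n_m (fun j => x j * (phi k t * phi j t)) 1 p) 1 p
    = (sum_n_m (fun j => x j * phi j t) 1 p) ^ 2).
  { intros t. set (T := sum_n_m (fun j => x j * phi j t) 1 p).
    rewrite (Rsum_ext p _ (fun k => T * (x k * phi k t))).
    - rewrite Rsum_scal_l. fold T. real_ring.
    - intros k _. rewrite (Rsum_ext p _ (fun j => phi k t * (x j * phi j t))).
      + rewrite Rsum_scal_l. fold T. real_ring.
      + intros j _. real_ring. }
  assert (Hval : sum_n_m (fun k => x k *
      sum_n_m (fun j => x j * (if Nat.eq_dec k j then c else 0)) 1 p) 1 p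
    = c * sum_n_m (fun j => x j ^ 2) 1 p).
  { rewrite <- Rsum_scal_l. apply Rsum_ext. intros k Hk.
    rewrite sum_kronecker by exact Hk. ring. }
  refine (is_RInt_eq _ _ _ _ _ _ _ Hsq Hval).
  apply (is_RInt_sum p (fun k t =>
    x k * sum_n_m (fun j => x j * (phi k t * phi j t)) 1 p)).
  intros k Hk.
  apply (@is_RInt_scal R_NormedModule).
  apply (is_RInt_sum p (fun j t => x j * (phi k t * phi j t))).
  intros j Hj.
  apply (@is_RInt_scal R_NormedModule).
  apply Horth; lia.
Qed.

(** * The Poisson kernel and a Schwarz lemma for cosine polynomials *)

Definition poisson_kernel (r t : R) : R := (1 - r ^ 2) / (1 - 2 * r * cos t + r ^ 2).

Lemma poisson_denominator_pos (r t : R) : 0 <= r < 1 -> 0 < 1 - 2 * r * cos t + r ^ 2.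
Proof.
  intros Hr. pose proof (COS_bound t). nra.
Qed.

Lemma continuous_poisson_kernel (r t : R) : 0 <= r < 1 -> continuous (poisson_kernel r) t.
Proof.
  intros Hr. apply (ex_derive_continuous (poisson_kernel r)).
  unfold poisson_kernel. auto_derive.
  pose proof (poisson_denominator_pos r t Hr). lra.
Qed.

(** The kernel is [1 + 2 Re (u / (1 - u))] at [u = r e^(it)], so the primitive is
    [t - 2 arg (1 - u)]. Written with [atan], it is smooth on the whole line,
    because [1 - r cos t > 0]. *)
Lemma is_RInt_poisson_kernel (r a b : R) : 0 <= r < 1 ->
  is_RInt (poisson_kernel r) a b
    ((b + 2 * atan (r * sin b / (1 - r * cos b)))
     - (a + 2 * atan (r * sin a / (1 - r * cos a)))).
Proof.
  intros Hr.
  apply (is_RInt_derive (V := R_CompleteNormedModule)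
    (fun t => t + 2 * atan (r * sin t / (1 - r * cos t)))).
  - intros t _.
    pose proof (COS_bound t). pose proof (poisson_denominator_pos r t Hr).
    assert (0 < 1 - r * cos t) by nra.
    pose proof (sin2_cos2 t) as Hsc. unfold Rsqr in Hsc.
    auto_derive; [lra|]. unfold poisson_kernel.
    assert (Hd : (1 - r * cos t) ^ 2 + (r * sin t) ^ 2 = 1 - 2 * r * cos t + r ^ 2) by nra.
    field_simplify_eq.
    + replace (sin t ^ 2) with (1 - cos t * cos t) by lra.
      ring.
    + repeat split; [lra|lra|].
      apply Rgt_not_eq. nra.
  - intros t _. now apply continuous_poisson_kernel.
Qed.

(** The denominator of the kernel turns [cos ((j+2) t) + cos (j t) =
    2 cos t cos ((j+1) t)] into a three-term recurrence for the moments, whose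
    solution with the right first two values is [PI r^j]. *)
Lemma is_RInt_poisson_kernel_cos (r : R) (j : nat) : 0 < r < 1 ->
  is_RInt (fun t => poisson_kernel r t * cos (INR j * t)) 0 PI (PI * r ^ j).
Proof.
  intros Hr.
  assert (Hden : forall t, 1 - 2 * r * cos t + r ^ 2 <> 0).
  { intros t. pose proof (poisson_denominator_pos r t). lra. }
  assert (H0 : is_RInt (poisson_kernel r) 0 PI PI).
  { apply (is_RInt_eq _ _ _ _ _ _ (is_RInt_poisson_kernel r 0 PI ltac:(lra))).
    - easy.
    - rewrite sin_PI, sin_0, !Rmult_0_r. unfold Rdiv. rewrite !Rmult_0_l, atan_0. ring. }
  enough (H : is_RInt (fun t => poisson_kernel r t * cos (INR j * t)) 0 PI (PI * r ^ j) /\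
              is_RInt (fun t => poisson_kernel r t * cos (INR (S j) * t)) 0 PI (PI * r ^ S j))
    by apply H.
  induction j as [|j [IH1 IH2]].
  - split.
    + rewrite pow_O, Rmult_1_r. revert H0. apply is_RInt_ext. intros t _.
      simpl INR. rewrite Rmult_0_l, cos_0. real_ring.
    + pose proof (is_RInt_lin2 _ _ _ _ _ _ ((1 + r ^ 2) / (2 * r))
        (- (1 - r ^ 2) / (2 * r)) H0 is_RInt_one) as H1.
      apply (is_RInt_eq _ _ _ _ _ _ H1); [|field; lra]. intros t.
      simpl INR. rewrite Rmult_1_l. unfold poisson_kernel. field.
      split; [apply Hden|lra].
  - split; [exact IH2|].
    assert (Hc : is_RInt (fun t => cos (INR (S j) * t)) 0 PI 0) by (apply is_RInt_cos_nat; lia).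
    pose proof (is_RInt_lin2 _ _ _ _ _ _ ((1 + r ^ 2) / r) (-1) IH2 IH1) as H1.
    pose proof (is_RInt_lin2 _ _ _ _ _ _ 1 (- (1 - r ^ 2) / r) H1 Hc) as H2.
    cbv beta in H2.
    apply (is_RInt_eq _ _ _ _ _ _ H2); [|simpl; field; lra]. intros t.
    assert (Hrec : cos (INR (S (S j)) * t)
      = 2 * cos t * cos (INR (S j) * t) - cos (INR j * t)).
    { replace (INR (S (S j)) * t) with (INR (S j) * t + t) by (rewrite (S_INR (S j)); ring).
      replace (INR j * t) with (INR (S j) * t - t) by (rewrite (S_INR j); ring).
      rewrite cos_plus, cos_minus. ring. }
    rewrite Hrec. unfold poisson_kernel. field. split; [apply Hden|lra].
Qed.

(** Let [T] be the cosine polynomial and [P] the kernel. Since [T] has mean 0,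
    [PI sum x_j r^j] is the integral of [(P - lam) T] for every constant [lam],
    hence at most [M] times the integral of [|P - lam|]. With [lam] the value
    of [P] at [PI / 2], the sign of [P - lam] is that of [cos], and the bound
    is [M ((PI / 2 + 2 atan r) - (PI / 2 - 2 atan r)) = 4 M atan r]. *)
Lemma cosine_polynomial_schwarz (p : nat) (x : nat -> R) (M r : R) :
  0 < r < 1 ->
  (forall t, Rabs (sum_n_m (fun j => x j * cos (INR j * t)) 1 p) <= M) ->
  sum_n_m (fun j => x j * r ^ j) 1 p <= M * (4 / PI * atan r).
Proof.
  intros Hr HM.
  pose proof PI_RGT_0 as Hpi.
  set (T := fun t : R => sum_n_m (fun j => x j * cos (INR j * t)) 1 p).
  set (lam := poisson_kernel r (PI / 2)).
  assert (HPT : is_RInt (fun t => poisson_kernel r t * T t) 0 PI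
            (PI * sum_n_m (fun j => x j * r ^ j) 1 p)).
  { refine (is_RInt_eq _ _ _ _ _ _ (is_RInt_sum p
      (fun j t => x j * (poisson_kernel r t * cos (INR j * t)))
      (fun j => x j * (PI * r ^ j)) 0 PI _) _ _).
    - intros j Hj. apply (@is_RInt_scal R_NormedModule). now apply is_RInt_poisson_kernel_cos.
    - intros t. unfold T. rewrite <- Rsum_scal_l. apply Rsum_ext. intros j _. ring.
    - rewrite <- Rsum_scal_l. apply Rsum_ext. intros j _. ring. }
  assert (HT : is_RInt T 0 PI 0).
  { refine (is_RInt_eq _ _ _ _ _ _ (is_RInt_sum p (fun j t => x j * cos (INR j * t))
      (fun j => x j * 0) 0 PI _) _ _).
    - intros j Hj. apply (@is_RInt_scal R_NormedModule). apply is_RInt_cos_nat. lia.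
    - easy.
    - rewrite (Rsum_ext p _ (fun j => 0 * x j)) by (intros; ring).
      rewrite Rsum_scal_l. ring. }
  set (g := fun t => 1 * (poisson_kernel r t * T t) + - lam * T t).
  assert (Htot : is_RInt g 0 PI
    (1 * (PI * sum_n_m (fun j => x j * r ^ j) 1 p) + - lam * 0)).
  { now apply is_RInt_lin2. }
  assert (Hval : r * sin (PI / 2) / (1 - r * cos (PI / 2)) = r).
  { rewrite sin_PI2, cos_PI2. field. }
  assert (H1 : is_RInt (poisson_kernel r) 0 (PI / 2) (PI / 2 + 2 * atan r)).
  { apply (is_RInt_eq _ _ _ _ _ _ (is_RInt_poisson_kernel r 0 (PI / 2) ltac:(lra))).
    - easy.
    - rewrite Hval, sin_0, Rmult_0_r.
      replace (0 / (1 - r * cos 0)) with 0 by (unfold Rdiv; ring). rewrite atan_0. ring. }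
  assert (H2 : is_RInt (poisson_kernel r) (PI / 2) PI (PI / 2 - 2 * atan r)).
  { apply (is_RInt_eq _ _ _ _ _ _ (is_RInt_poisson_kernel r (PI / 2) PI ltac:(lra))).
    - easy.
    - rewrite Hval, sin_PI, Rmult_0_r.
      replace (0 / (1 - r * cos PI)) with 0 by (unfold Rdiv; ring). rewrite atan_0. field. }
  assert (Hc1 : is_RInt (fun _ => 1) 0 (PI / 2) (PI / 2)).
  { replace (PI / 2) with ((PI / 2 - 0) * 1) at 2 by ring. apply is_RInt_const_R. }
  assert (Hc2 : is_RInt (fun _ => 1) (PI / 2) PI (PI / 2)).
  { replace (PI / 2) with ((PI - PI / 2) * 1) at 2 by field. apply is_RInt_const_R. }
  pose proof (is_RInt_lin2 _ _ _ _ _ _ M (- (M * lam)) H1 Hc1) as K1.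
  pose proof (is_RInt_lin2 _ _ _ _ _ _ (- M) (M * lam) H2 Hc2) as K2.
  cbv beta in K1, K2.
  destruct (ex_RInt_Chasles_1 (V := R_CompleteNormedModule) g 0 (PI / 2) PI)
    as [l1 Hl1]; [lra|eexists; exact Htot|].
  destruct (ex_RInt_Chasles_2 (V := R_CompleteNormedModule) g 0 (PI / 2) PI)
    as [l2 Hl2]; [lra|eexists; exact Htot|].
  assert (Hsum : l1 + l2 = 1 * (PI * sum_n_m (fun j => x j * r ^ j) 1 p) + - lam * 0).
  { transitivity (RInt (V := R_CompleteNormedModule) g 0 PI); [symmetry|];
      apply is_RInt_unique; [exact (is_RInt_Chasles _ _ _ _ _ _ Hl1 Hl2)|exact Htot]. }
  assert (Hlam : lam = (1 - r ^ 2) / (1 + r ^ 2)).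
  { unfold lam, poisson_kernel. rewrite cos_PI2. f_equal. ring. }
  assert (HTM : forall t, - M <= T t <= M).
  { intros t. apply Rabs_le_between. apply HM. }
  assert (B1 : l1 <= M * (PI / 2 + 2 * atan r) + - (M * lam) * (PI / 2)).
  { refine (is_RInt_le _ _ _ _ _ _ _ Hl1 K1 _); [lra|]. intros t Ht.
    assert (lam <= poisson_kernel r t).
    { rewrite Hlam. unfold poisson_kernel. apply Rmult_le_compat_l; [nra|].
      apply Rinv_le_contravar; [apply poisson_denominator_pos; lra|].
      assert (0 <= cos t) by (apply cos_ge_0; lra). nra. }
    specialize (HTM t). unfold g. nra. }
  assert (B2 : l2 <= - M * (PI / 2 - 2 * atan r) + M * lam * (PI / 2)).
  { refine (is_RInt_le _ _ _ _ _ _ _ Hl2 K2 _); [lra|]. intros t Ht.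
    assert (poisson_kernel r t <= lam).
    { rewrite Hlam. unfold poisson_kernel. apply Rmult_le_compat_l; [nra|].
      apply Rinv_le_contravar; [nra|].
      assert (cos t <= 0) by (apply cos_le_0; lra). nra. }
    specialize (HTM t). unfold g. nra. }
  apply (Rmult_le_reg_l PI); [lra|].
  replace (PI * (M * (4 / PI * atan r))) with (M * (4 * atan r)) by (field; lra).
  lra.
Qed.

(** * Harmonic polynomials *)

Definition cis (t : R) : C := (cos t, sin t).

Lemma Cmod_cis (t : R) : Cmod (cis t) = 1.
Proof.
  unfold Cmod, cis; simpl fst; simpl snd. rewrite <- sqrt_1. f_equal.
  pose proof (sin2_cos2 t) as H. unfold Rsqr in H. lra.
Qed.

Lemma Cconj_cis (t : R) : Cconj (cis t) = cis (- t).
Proof. unfold cis, Cconj; simpl. now rewrite cos_neg, sin_neg. Qed.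

Lemma cis_pow (t : R) (n : nat) : (cis t ^ n)%C = cis (INR n * t).
Proof.
  induction n as [|n IH].
  - simpl INR. rewrite Rmult_0_l. unfold cis. now rewrite cos_0, sin_0.
  - rewrite Cpow_S, IH.
    replace (INR (S n) * t) with (t + INR n * t) by (rewrite S_INR; ring).
    unfold cis, Cmult; simpl. rewrite cos_plus, sin_plus. f_equal; ring.
Qed.

Definition harmonic_poly (p : nat) (a b : nat -> C) (z : C) : C :=
  sum_n_m (fun j => (a j * z ^ j + Cconj (b j) * Cconj z ^ j)%C) 1 p.

Lemma harmonic_poly_S (p : nat) (a b : nat -> C) (z : C) :
  harmonic_poly (S p) a b z =
  (harmonic_poly p a b z + (a (S p) * z ^ S p + Cconj (b (S p)) * Cconj z ^ S p))%C.
Proof. apply Csum_S. Qed.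

(** Combinations with real weights [c]: their real and imaginary parts are
    taken termwise, which reduces complex sums to real cosine and sine
    polynomials. *)
Definition real_comb (c : nat -> R) (d : nat -> C) (p : nat) : C :=
  sum_n_m (fun j => (RtoC (c j) * d j)%C) 1 p.

Lemma real_comb_S (c : nat -> R) (d : nat -> C) (p : nat) :
  real_comb c d (S p) = (real_comb c d p + RtoC (c (S p)) * d (S p))%C.
Proof. apply Csum_S. Qed.

(** The factor [w] allows a projection onto an arbitrary direction. *)
Lemma Re_real_comb (p : nat) (c : nat -> R) (d : nat -> C) (w : C) :
  Re (w * real_comb c d p)%C = sum_n_m (fun j => Re (w * d j)%C * c j) 1 p.
Proof.
  induction p as [|p IH].
  - unfold real_comb. rewrite Csum_0, Rsum_0. simpl. ring.
  - rewrite Rsum_S, <- IH, real_comb_S. simpl. real_ring.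
Qed.

Lemma Im_real_comb (p : nat) (c : nat -> R) (d : nat -> C) :
  Im (real_comb c d p) = sum_n_m (fun j => Im (d j) * c j) 1 p.
Proof.
  induction p as [|p IH].
  - unfold real_comb. rewrite Csum_0, Rsum_0. reflexivity.
  - rewrite Rsum_S, <- IH, real_comb_S. unfold Im; simpl. real_ring.
Qed.

Lemma Re_real_comb_1 (p : nat) (c : nat -> R) (d : nat -> C) :
  Re (real_comb c d p) = sum_n_m (fun j => Re (d j) * c j) 1 p.
Proof.
  rewrite <- (Cmult_1_l (real_comb c d p)), Re_real_comb.
  apply Rsum_ext. intros j _. now rewrite Cmult_1_l.
Qed.

(** Replacing [t] by [- t] conjugates [cis t], hence exchanges the two
    exponentials in each term: the even part in [t] involves only cosines,
    with the coefficients that give the values on the ray through [zeta]. *)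
Lemma harmonic_poly_even_part (p : nat) (a b : nat -> C) (zeta : C) (t : R) :
  (harmonic_poly p a b (zeta * cis t) + harmonic_poly p a b (zeta * cis (- t)))%C
  = (RtoC 2 * real_comb (fun j => cos (INR j * t))
       (fun j => (a j * zeta ^ j + Cconj (b j) * Cconj zeta ^ j)%C) p)%C.
Proof.
  induction p as [|p IH].
  - unfold harmonic_poly, real_comb. rewrite !Csum_0. ring.
  - rewrite !harmonic_poly_S, real_comb_S.
    rewrite !Cmult_conj, !Cconj_cis, Ropp_involutive, !Cpow_mult_l, !cis_pow.
    replace (INR (S p) * - t) with (- (INR (S p) * t)) by ring.
    rewrite Cmult_plus_distr_l, <- IH.
    set (s := INR (S p) * t).
    assert (Hc : (RtoC 2 * RtoC (cos s) = cis s + cis (- s))%C).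
    { unfold cis, RtoC, Cmult, Cplus; simpl. rewrite cos_neg, sin_neg. f_equal; ring. }
    rewrite (Cmult_assoc (RtoC 2) (RtoC (cos s))), Hc. ring.
Qed.

Lemma harmonic_poly_odd_part (p : nat) (a b : nat -> C) (zeta : C) (t : R) :
  (harmonic_poly p a b (zeta * cis t) - harmonic_poly p a b (zeta * cis (- t)))%C
  = (RtoC 2 * Ci * real_comb (fun j => sin (INR j * t))
       (fun j => (a j * zeta ^ j - Cconj (b j) * Cconj zeta ^ j)%C) p)%C.
Proof.
  induction p as [|p IH].
  - unfold harmonic_poly, real_comb. rewrite !Csum_0. ring.
  - rewrite !harmonic_poly_S, real_comb_S.
    rewrite !Cmult_conj, !Cconj_cis, Ropp_involutive, !Cpow_mult_l, !cis_pow.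
    replace (INR (S p) * - t) with (- (INR (S p) * t)) by ring.
    rewrite Cmult_plus_distr_l, <- IH.
    set (s := INR (S p) * t).
    assert (Hc : (RtoC 2 * Ci * RtoC (sin s) = cis s - cis (- s))%C).
    { unfold cis, RtoC, Cmult, Cminus, Copp, Cplus; simpl.
      rewrite cos_neg, sin_neg. f_equal; ring. }
    rewrite (Cmult_assoc (RtoC 2 * Ci) (RtoC (sin s))), Hc. ring.
Qed.

Lemma harmonic_poly_ray (p : nat) (a b : nat -> C) (zeta : C) (r : R) :
  harmonic_poly p a b (RtoC r * zeta)%C
  = real_comb (fun j => r ^ j)
      (fun j => (a j * zeta ^ j + Cconj (b j) * Cconj zeta ^ j)%C) p.
Proof.
  induction p as [|p IH].
  - unfold harmonic_poly, real_comb. now rewrite !Csum_0.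
  - rewrite harmonic_poly_S, real_comb_S, IH.
    assert (Hr : Cconj (RtoC r) = RtoC r).
    { unfold Cconj, RtoC; simpl. now rewrite Ropp_0. }
    rewrite Cmult_conj, Hr, !Cpow_mult_l, <- RtoC_pow. ring.
Qed.

Lemma Cmod_pow_sub (z w : C) (n : nat) : Cmod z <= 1 -> Cmod w <= 1 ->
  Cmod (z ^ n - w ^ n)%C <= INR n * Cmod (z - w)%C.
Proof.
  intros Hz Hw. induction n as [|n IH].
  - simpl INR. replace (z ^ 0 - w ^ 0)%C with (RtoC 0) by (simpl; ring).
    rewrite Cmod_0. lra.
  - replace (z ^ S n - w ^ S n)%C with (z * (z ^ n - w ^ n) + (z - w) * w ^ n)%C
      by (rewrite !Cpow_S; ring).
    eapply Rle_trans; [apply Cmod_triangle|].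
    rewrite !Cmod_mult, Cmod_pow, S_INR.
    pose proof (Cmod_ge_0 z). pose proof (Cmod_ge_0 w).
    pose proof (Cmod_ge_0 (z - w)%C). pose proof (Cmod_ge_0 (z ^ n - w ^ n)%C).
    assert (Cmod w ^ n <= 1) by (rewrite <- (pow1 n); now apply pow_incr).
    nra.
Qed.

Lemma harmonic_poly_lipschitz (p : nat) (a b : nat -> C) (z w : C) :
  Cmod z <= 1 -> Cmod w <= 1 ->
  Cmod (harmonic_poly p a b z - harmonic_poly p a b w)%C
  <= sum_n_m (fun j => INR j * (Cmod (a j) + Cmod (b j))) 1 p * Cmod (z - w)%C.
Proof.
  intros Hz Hw. induction p as [|p IH].
  - unfold harmonic_poly. rewrite !Csum_0, Rsum_0.
    replace (RtoC 0 - RtoC 0)%C with (RtoC 0) by ring. rewrite Cmod_0. lra.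
  - rewrite !harmonic_poly_S, Rsum_S.
    match goal with |- Cmod ?e <= _ => replace e with
      ((harmonic_poly p a b z - harmonic_poly p a b w)
       + (a (S p) * (z ^ S p - w ^ S p)
          + Cconj (b (S p)) * Cconj (z ^ S p - w ^ S p)))%C
      by (rewrite Cminus_conj, !Cpow_conj; ring) end.
    eapply Rle_trans; [apply Cmod_triangle|].
    rewrite Rmult_plus_distr_r. apply Rplus_le_compat; [exact IH|].
    eapply Rle_trans; [apply Cmod_triangle|].
    rewrite !Cmod_mult, !Cmod_conj.
    pose proof (Cmod_pow_sub z w (S p) Hz Hw).
    pose proof (Cmod_ge_0 (a (S p))). pose proof (Cmod_ge_0 (b (S p))).
    nra.
Qed.

(** Approximate [z] by [(1 - delta) z] and use the Lipschitz bound. *)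
Lemma harmonic_poly_bound_closed (p : nat) (a b : nat -> C) :
  (forall z, Cmod z < 1 -> Cmod (harmonic_poly p a b z) <= 1) ->
  forall z, Cmod z <= 1 -> Cmod (harmonic_poly p a b z) <= 1.
Proof.
  intros HF z Hz.
  set (L := sum_n_m (fun j => INR j * (Cmod (a j) + Cmod (b j))) 1 p).
  assert (HL : 0 <= L).
  { unfold L. clear. induction p as [|p IH].
    - rewrite Rsum_0. lra.
    - rewrite Rsum_S. pose proof (pos_INR (S p)).
      pose proof (Cmod_ge_0 (a (S p))). pose proof (Cmod_ge_0 (b (S p))).
      apply Rplus_le_le_0_compat; [exact IH|nra]. }
  apply le_epsilon. intros eps Heps.
  (* This makes [L * delta <= eps] while keeping [delta <= 1], also when [L = 0]. *)
  set (delta := eps / (eps + L)).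
  assert (Hdelta : delta * (eps + L) = eps) by (unfold delta; field; lra).
  assert (Hdelta0 : 0 < delta) by (apply Rdiv_lt_0_compat; lra).
  assert (Hdelta1 : delta <= 1) by nra.
  set (w := (RtoC (1 - delta) * z)%C).
  pose proof (Cmod_ge_0 z) as Hz0.
  assert (Hw : Cmod w < 1).
  { unfold w. rewrite Cmod_mult, Cmod_R, Rabs_pos_eq by lra. nra. }
  assert (Hzw : Cmod (z - w)%C <= delta).
  { replace (z - w)%C with (RtoC delta * z)%C
      by (unfold w; rewrite RtoC_minus; ring).
    rewrite Cmod_mult, Cmod_R, Rabs_pos_eq by lra. nra. }
  pose proof (harmonic_poly_lipschitz p a b z w Hz (Rlt_le _ _ Hw)) as Hlip.
  fold L in Hlip. specialize (HF w Hw).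
  pose proof (Cmod_triangle (harmonic_poly p a b w)
    (harmonic_poly p a b z - harmonic_poly p a b w)%C) as Htri.
  replace (harmonic_poly p a b w + (harmonic_poly p a b z - harmonic_poly p a b w))%C
    with (harmonic_poly p a b z) in Htri by ring.
  nra.
Qed.

(** * The harmonic Schwarz lemma *)

(** Project onto the direction of the value [w] to be estimated; using [w]
    itself instead of its unit vector avoids a division. *)
Lemma cosine_polynomial_schwarz_C (p : nat) (d : nat -> C) (r : R) :
  0 < r < 1 ->
  (forall t, Cmod (real_comb (fun j => cos (INR j * t)) d p) <= 1) ->
  Cmod (real_comb (fun j => r ^ j) d p) <= 4 / PI * atan r.
Proof.
  intros Hr Hd.
  set (w := real_comb (fun j => r ^ j) d p).
  assert (H : sum_n_m (fun j => Re (Cconj w * d j)%C * r ^ j) 1 p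
              <= Cmod w * (4 / PI * atan r)).
  { apply cosine_polynomial_schwarz; [exact Hr|]. intros t.
    rewrite <- Re_real_comb. eapply Rle_trans; [apply re_le_Cmod|].
    rewrite Cmod_mult, Cmod_conj. specialize (Hd t).
    pose proof (Cmod_ge_0 w). nra. }
  rewrite <- Re_real_comb in H. change (real_comb (pow r) d p) with w in H.
  replace (Re (Cconj w * w)%C) with (Cmod w ^ 2) in H.
  2:{ rewrite Cmod2_alt. unfold Re, Im; simpl. ring. }
  destruct (Cmod_ge_0 w) as [Hw|Hw].
  { apply (Rmult_le_reg_l (Cmod w)); [exact Hw|]. lra. }
  rewrite <- Hw. apply Rmult_le_pos.
  - apply Rlt_le, Rdiv_lt_0_compat; [lra|apply PI_RGT_0].
  - rewrite <- atan_0. apply Rlt_le, atan_increasing. lra.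
Qed.

(** [1 / 2] is the derivative at 1, and [atan] is concave on [[0, 1]]. *)
Lemma atan_le_tangent_at_1 (r : R) : r < 1 -> 0 <= r -> atan r <= PI / 4 - (1 - r) / 2.
Proof.
  intros H1 H0. rewrite <- atan_1.
  destruct (MVT_cor2 atan (fun c => / (1 + c ^ 2)) r 1 H1) as [c [Hc Hc']].
  { intros c _. apply is_derive_Reals. auto_derive; [easy|]. field. nra. }
  assert (/ 2 <= / (1 + c ^ 2)) by (apply Rinv_le_contravar; nra).
  nra.
Qed.

(** A linear form of [|f z| <= (4 / PI) atan |z|]: the even part of [f] about
    the ray through [z] is an average of two values on the circle, so it is a
    cosine polynomial bounded by 1. *)
Lemma harmonic_poly_schwarz (p : nat) (a b : nat -> C) (z : C) :
  (forall z, Cmod z <= 1 -> Cmod (harmonic_poly p a b z) <= 1) ->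
  Cmod z < 1 ->
  Cmod (harmonic_poly p a b z) <= 1 - 2 / PI * (1 - Cmod z).
Proof.
  intros HF Hz. pose proof PI_RGT_0 as Hpi. pose proof PI2_1 as Hpi2.
  destruct (Cmod_ge_0 z) as [Hz0|Hz0].
  - set (r := Cmod z) in *.
    assert (Hr : RtoC r <> 0) by (intros E; apply RtoC_inj in E; lra).
    set (zeta := (z / RtoC r)%C).
    assert (Hzeta : Cmod zeta = 1).
    { unfold zeta. rewrite Cmod_div by exact Hr.
      rewrite Cmod_R, Rabs_pos_eq by lra. fold r. field. lra. }
    replace z with (RtoC r * zeta)%C by (unfold zeta; field; exact Hr).
    rewrite harmonic_poly_ray.
    apply Rle_trans with (4 / PI * atan r).
    + apply cosine_polynomial_schwarz_C; [lra|]. intros t.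
      assert (Hc : forall s, Cmod (harmonic_poly p a b (zeta * cis s)%C) <= 1).
      { intros s. apply HF. rewrite Cmod_mult, Cmod_cis. lra. }
      pose proof (Cmod_triangle (harmonic_poly p a b (zeta * cis t))
        (harmonic_poly p a b (zeta * cis (- t)))) as Htri.
      rewrite harmonic_poly_even_part, Cmod_mult, Cmod_R, Rabs_pos_eq in Htri by lra.
      pose proof (Hc t). pose proof (Hc (- t)). lra.
    + pose proof (atan_le_tangent_at_1 r Hz (Rlt_le _ _ Hz0)) as Hat.
      replace (1 - 2 / PI * (1 - r)) with (4 / PI * (PI / 4 - (1 - r) / 2)) by (field; lra).
      apply Rmult_le_compat_l; [|exact Hat].
      apply Rlt_le, Rdiv_lt_0_compat; lra.
  - rewrite <- Hz0. symmetry in Hz0. apply Cmod_eq_0 in Hz0. subst z.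
    assert (H0 : harmonic_poly p a b (RtoC 0) = RtoC 0).
    { clear. induction p as [|p IH]; [apply Csum_0|].
      rewrite harmonic_poly_S, IH, !Cpow_S.
      replace (Cconj (RtoC 0)) with (RtoC 0)
        by (unfold Cconj, RtoC; simpl; now rewrite Ropp_0). ring. }
    rewrite H0, Cmod_0.
    assert (2 / PI <= 1) by (apply Rle_div_l; lra). lra.
Qed.

(** * The Lipschitz constant *)

(** The even part [G] and the odd part [H] of [f] on the circle satisfy
    [|G|^2 + |H|^2 <= 1] by the parallelogram law. Their coefficients are
    [u_j = a_j + conj b_j] and [v_j = a_j - conj b_j], and the same law gives
    [|u_j|^2 + |v_j|^2 = 2 (|a_j|^2 + |b_j|^2)]. *)
Lemma harmonic_poly_bessel (p : nat) (a b : nat -> C) :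
  (forall z, Cmod z <= 1 -> Cmod (harmonic_poly p a b z) <= 1) ->
  sum_n_m (fun j => Cmod (a j) ^ 2 + Cmod (b j) ^ 2) 1 p <= 1.
Proof.
  intros HF. pose proof PI_RGT_0 as Hpi.
  set (u := fun j => (a j * RtoC 1 ^ j + Cconj (b j) * Cconj (RtoC 1) ^ j)%C).
  set (v := fun j => (a j * RtoC 1 ^ j - Cconj (b j) * Cconj (RtoC 1) ^ j)%C).
  set (G := fun t => real_comb (fun j => cos (INR j * t)) u p).
  set (H := fun t => real_comb (fun j => sin (INR j * t)) v p).
  assert (Hpt : forall t, Cmod (G t) ^ 2 + Cmod (H t) ^ 2 <= 1).
  { intros t.
    assert (Hc : forall s, Cmod (harmonic_poly p a b (RtoC 1 * cis s)%C) <= 1).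
    { intros s. apply HF. rewrite Cmod_mult, Cmod_cis, Cmod_1. lra. }
    pose proof (harmonic_poly_even_part p a b (RtoC 1) t) as He.
    pose proof (harmonic_poly_odd_part p a b (RtoC 1) t) as Ho.
    fold u in He. fold v in Ho. fold (G t) in He. fold (H t) in Ho.
    pose proof (Hc t) as H1. pose proof (Hc (- t)) as H2.
    set (X := harmonic_poly p a b (RtoC 1 * cis t)) in *.
    set (Y := harmonic_poly p a b (RtoC 1 * cis (- t))) in *.
    assert (E1 : Cmod (X + Y)%C ^ 2 = 4 * Cmod (G t) ^ 2).
    { rewrite He, Cmod_mult, Cmod_R, Rabs_pos_eq by lra. ring. }
    assert (E2 : Cmod (X - Y)%C ^ 2 = 4 * Cmod (H t) ^ 2).
    { rewrite Ho, !Cmod_mult, Cmod_R, Cmod_Ci, Rabs_pos_eq by lra. ring. }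
    assert (E3 : Cmod (X + Y)%C ^ 2 + Cmod (X - Y)%C ^ 2 = 2 * Cmod X ^ 2 + 2 * Cmod Y ^ 2).
    { rewrite !Cmod2_alt. unfold Re, Im; simpl. ring. }
    pose proof (Cmod_ge_0 X). pose proof (Cmod_ge_0 Y). nra. }
  assert (Hcos := fun x => parseval p (fun j t => cos (INR j * t)) (PI / 2) x
    (fun j k Hj Hk => proj1 (trig_orthogonality j k Hj Hk))).
  assert (Hsin := fun x => parseval p (fun j t => sin (INR j * t)) (PI / 2) x
    (fun j k Hj Hk => proj2 (trig_orthogonality j k Hj Hk))).
  cbv beta in Hcos, Hsin.
  pose proof (is_RInt_lin2 _ _ _ _ _ _ 1 1
    (is_RInt_lin2 _ _ _ _ _ _ 1 1 (Hcos (fun j => Re (u j))) (Hcos (fun j => Im (u j))))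
    (is_RInt_lin2 _ _ _ _ _ _ 1 1 (Hsin (fun j => Re (v j))) (Hsin (fun j => Im (v j)))))
    as HI.
  cbv beta in HI.
  assert (Hsum : sum_n_m (fun j => Re (u j) ^ 2) 1 p + sum_n_m (fun j => Im (u j) ^ 2) 1 p
    + (sum_n_m (fun j => Re (v j) ^ 2) 1 p + sum_n_m (fun j => Im (v j) ^ 2) 1 p)
    = 2 * sum_n_m (fun j => Cmod (a j) ^ 2 + Cmod (b j) ^ 2) 1 p).
  { clear. induction p as [|p IH].
    - rewrite !Rsum_0. ring.
    - rewrite !Rsum_S.
      assert (E : Re (u (S p)) ^ 2 + Im (u (S p)) ^ 2 + (Re (v (S p)) ^ 2 + Im (v (S p)) ^ 2)
        = 2 * (Cmod (a (S p)) ^ 2 + Cmod (b (S p)) ^ 2)).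
      { unfold u, v. rewrite <- Cpow_conj, Cpow_1_l, !Cmod2_alt.
        unfold Re, Im; simpl. ring. }
      lra. }
  assert (Hle : PI * sum_n_m (fun j => Cmod (a j) ^ 2 + Cmod (b j) ^ 2) 1 p <= PI).
  { refine (is_RInt_le _ _ _ _ _ _ _ (is_RInt_eq _ _ _ _ _ _ HI (fun t => eq_refl) _)
      is_RInt_one _); [lra| |].
    - match goal with |- _ = PI * ?S => replace (PI * S) with (PI / 2 * (2 * S)) by field end.
      rewrite <- Hsum. real_ring.
    - intros t _. specialize (Hpt t). rewrite !Cmod2_alt in Hpt.
      unfold G, H in Hpt. rewrite !Re_real_comb_1, !Im_real_comb in Hpt. lra. }
  nra.
Qed.

(** The Cauchy-Schwarz inequality in the form [mu x <= (1 + mu^2 x^2) / 2],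
    summed over the [2 p] numbers [|a_j|], [|b_j|] with the optimal weight
    [mu = sqrt (2 p)]. *)
Lemma harmonic_lipschitz_constant_le (p : nat) (a b : nat -> C) : (1 <= p)%nat ->
  sum_n_m (fun j => Cmod (a j) ^ 2 + Cmod (b j) ^ 2) 1 p <= 1 ->
  sum_n_m (fun j => INR j * (Cmod (a j) + Cmod (b j))) 1 p <= INR p * sqrt (2 * INR p).
Proof.
  intros Hp Hsq.
  assert (HP : 1 <= INR p) by (change 1 with (INR 1); now apply le_INR).
  set (mu := sqrt (2 * INR p)).
  assert (Hmu : 0 < mu) by (apply sqrt_lt_R0; lra).
  assert (Hmu2 : mu * mu = 2 * INR p) by (apply sqrt_sqrt; lra).
  assert (Hall : forall q, (q <= p)%nat ->
    mu * sum_n_m (fun j => INR j * (Cmod (a j) + Cmod (b j))) 1 q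
    <= INR p * (INR q + INR p * sum_n_m (fun j => Cmod (a j) ^ 2 + Cmod (b j) ^ 2) 1 q)).
  { induction q as [|q IH]; intros Hq.
    - rewrite !Rsum_0. simpl INR. lra.
    - rewrite !Rsum_S. specialize (IH ltac:(lia)).
      assert (Hj : INR (S q) <= INR p) by now apply le_INR.
      pose proof (pos_INR (S q)).
      set (x := Cmod (a (S q))). set (y := Cmod (b (S q))).
      pose proof (Cmod_ge_0 (a (S q)) : 0 <= x). pose proof (Cmod_ge_0 (b (S q)) : 0 <= y).
      assert (Hxy : mu * (x + y) <= 1 + INR p * (x ^ 2 + y ^ 2)).
      { pose proof (pow2_ge_0 (mu * x - 1)). pose proof (pow2_ge_0 (mu * y - 1)).
        assert (mu ^ 2 * (x ^ 2 + y ^ 2) = 2 * INR p * (x ^ 2 + y ^ 2))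
          by (rewrite <- Hmu2; ring). nra. }
      assert (Hxy0 : 0 <= mu * (x + y)) by nra.
      assert (mu * (INR (S q) * (x + y)) <= INR p * (1 + INR p * (x ^ 2 + y ^ 2))) by nra.
      rewrite (S_INR q) at 2. lra. }
  specialize (Hall p (Nat.le_refl p)).
  apply (Rmult_le_reg_l mu); [exact Hmu|].
  eapply Rle_trans; [exact Hall|].
  replace (mu * (INR p * mu)) with (INR p * (mu * mu)) by ring. rewrite Hmu2.
  apply Rmult_le_compat_l; [lra|]. nra.
Qed.

(** * The distance ratio metric of the disk *)

Lemma continuous_Cmod (z : C) : continuous (U := R_UniformSpace) Cmod z.
Proof.
  exact (filterlim_norm (V := C_NormedModule) z).
Qed.

Lemma Cmod_triangle_inverse (z w : C) : Cmod z - Cmod w <= Cmod (z - w)%C.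
Proof.
  pose proof (Cmod_triangle (z - w) w) as H.
  replace (z - w + w)%C with z in H by ring. lra.
Qed.

(** Points of a neighbourhood on both sides of [z] in the direction [v]; for
    [v = z] on the circle they lie outside and inside the disk. *)
Lemma locally_point (P : C -> Prop) (z : C) (v : C) :
  locally z P -> exists s, 0 < s < 1 /\
     P (z + RtoC s * v)%C /\ P (z - RtoC s * v)%C.
Proof.
  intros [eps H].
  pose proof (Cmod_ge_0 v) as Hv. pose proof (cond_pos eps) as He.
  set (s := Rmin (1/2) (eps / (2 * (Cmod v + 1)))).
  assert (H1 : 0 < eps / (2 * (Cmod v + 1))) by (apply Rdiv_lt_0_compat; lra).
  assert (Hs0 : 0 < s) by (apply Rmin_glb_lt; lra).
  assert (Hs1 : s <= 1/2) by apply Rmin_l.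
  assert (Hs2 : s * (2 * (Cmod v + 1)) <= eps).
  { apply Rle_div_r; [lra|]. apply Rmin_r. }
  exists s. split; [lra|].
  split; apply H, C_NormedModule_mixin_compat1; change minus with Cminus.
  - replace (z + RtoC s * v - z)%C with (RtoC s * v)%C by ring.
    rewrite Cmod_mult, Cmod_R, Rabs_pos_eq by lra. nra.
  - replace (z - RtoC s * v - z)%C with (RtoC (- s) * v)%C by (rewrite RtoC_opp; ring).
    rewrite Cmod_mult, Cmod_R, Rabs_left by lra. nra.
Qed.

Lemma boundary_unit_disk (z : C) : boundary unit_disk z <-> Cmod z = 1.
Proof.
  unfold boundary, unit_disk. split.
  - intros [Hadh Hint].
    destruct (Rtotal_order (Cmod z) 1) as [Hlt|[Heq|Hgt]]; [exfalso|exact Heq|exfalso].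
    + apply Hint. apply (continuous_Cmod z (fun r => r < 1)).
      now apply (open_lt 1).
    + apply Hadh. apply (continuous_Cmod z (fun r => ~ r < 1)).
      apply (filter_imp (fun r => 1 < r)); [intros r Hr; lra|].
      now apply (open_gt 1).
  - intros Hz. split; intros H; destruct (locally_point _ _ z H) as [s [Hs [H1 H2]]].
    + apply H2. replace (z - RtoC s * z)%C with (RtoC (1 - s) * z)%C
        by (rewrite RtoC_minus; ring).
      rewrite Cmod_mult, Cmod_R, Rabs_pos_eq, Hz by lra. lra.
    + replace (z + RtoC s * z)%C with (RtoC (1 + s) * z)%C in H1
        by (rewrite RtoC_plus; ring).
      rewrite Cmod_mult, Cmod_R, Rabs_pos_eq, Hz in H1 by lra. lra.
Qed.

Lemma exists_nearest_unit (z : C) : Cmod z < 1 ->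
  exists w, Cmod w = 1 /\ Cmod (z - w)%C = 1 - Cmod z.
Proof.
  intros Hz. destruct (Cmod_ge_0 z) as [H0|H0].
  - set (r := Cmod z) in *.
    assert (Hr : RtoC r <> 0) by (intros E; apply RtoC_inj in E; lra).
    assert (Hu : Cmod (z / RtoC r)%C = 1).
    { rewrite Cmod_div by exact Hr. rewrite Cmod_R, Rabs_pos_eq by lra.
      fold r. field. lra. }
    exists (z / RtoC r)%C. split; [exact Hu|].
    replace (z - z / RtoC r)%C with (RtoC (r - 1) * (z / RtoC r))%C
      by (rewrite RtoC_minus; field; exact Hr).
    rewrite Cmod_mult, Hu, Cmod_R, Rabs_left by lra. ring.
  - exists (RtoC 1). split; [apply Cmod_1|].
    rewrite <- H0. symmetry in H0. apply Cmod_eq_0 in H0. subst z.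
    replace (RtoC 0 - RtoC 1)%C with (RtoC (-1))
      by (unfold RtoC, Cminus, Cplus, Copp; simpl; f_equal; ring).
    rewrite Cmod_R, Rabs_left by lra. ring.
Qed.

Lemma dist_boundary_unit_disk (z : C) : Cmod z < 1 ->
  dist_boundary unit_disk z = 1 - Cmod z.
Proof.
  intros Hz. unfold dist_boundary.
  rewrite (is_glb_Rbar_unique _ (Finite (1 - Cmod z))); [reflexivity|].
  split.
  - intros r [w [Hw ->]]. apply boundary_unit_disk in Hw. simpl.
    pose proof (Cmod_triangle_inverse w z) as H.
    replace (z - w)%C with (- (w - z))%C by ring. rewrite Cmod_opp. lra.
  - intros m Hm. apply Hm.
    destruct (exists_nearest_unit z Hz) as [w [Hw Hd]].
    exists w. split; [now apply boundary_unit_disk|now symmetry].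
Qed.

(** The derivative [c / (1 + t) - c / (1 + c t)] of the difference is positive
    for [t > 0]. *)
Lemma ln_strict_bernoulli (c x : R) : 1 < c -> 0 < x ->
  ln (1 + c * x) < c * ln (1 + x).
Proof.
  intros Hc Hx.
  destruct (MVT_cor2 (fun t => c * ln (1 + t) - ln (1 + c * t))
    (fun t => c / (1 + t) - c / (1 + c * t)) 0 x Hx) as [t [Ht Ht']].
  { intros t Ht. apply is_derive_Reals.
    assert (0 <= c * t) by nra.
    auto_derive; [lra|]. field. lra. }
  rewrite Rmult_0_r, Rplus_0_r, ln_1, Rmult_0_r, Rminus_diag, !Rminus_0_r in Ht.
  assert (0 < c * t) by nra.
  assert (c / (1 + c * t) < c / (1 + t)).
  { apply Rmult_lt_compat_l; [lra|]. apply Rinv_lt_contravar; nra. }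
  nra.
Qed.

(** The quotient inside the logarithm grows at most by [K / q]. This factor
    exceeds 1 and the quotient is positive, so passing to the logarithm gives a
    strict inequality. *)
Lemma j_metric_unit_disk_lt (K q : R) (z w z' w' : C) :
  unit_disk z -> unit_disk w -> unit_disk z' -> unit_disk w' -> z <> w ->
  0 < q < K ->
  Cmod (z' - w')%C <= K * Cmod (z - w)%C ->
  q * (1 - Cmod z) <= 1 - Cmod z' ->
  q * (1 - Cmod w) <= 1 - Cmod w' ->
  j_metric unit_disk z' w' < K / q * j_metric unit_disk z w.
Proof.
  unfold unit_disk. intros Hz Hw Hz' Hw' Hne Hq Hlip Hqz Hqw.
  unfold j_metric. rewrite !dist_boundary_unit_disk by assumption.
  set (m := Rmin (1 - Cmod z) (1 - Cmod w)).
  set (m' := Rmin (1 - Cmod z') (1 - Cmod w')).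
  assert (Hm : 0 < m) by (apply Rmin_glb_lt; lra).
  assert (Hm' : q * m <= m').
  { assert (m <= 1 - Cmod z) by apply Rmin_l.
    assert (m <= 1 - Cmod w) by apply Rmin_r.
    apply Rmin_glb; nra. }
  assert (Hqm : 0 < q * m) by nra.
  assert (Hd : 0 < Cmod (z - w)%C).
  { apply Cmod_gt_0. intros E. apply Hne.
    replace z with ((z - w) + w)%C by ring. rewrite E. ring. }
  assert (Hx : 0 < Cmod (z - w)%C / m) by now apply Rdiv_lt_0_compat.
  assert (Hc : 1 < K / q) by (apply Rlt_div_r; lra).
  pose proof (Cmod_ge_0 (z' - w')%C) as Hd'.
  eapply Rle_lt_trans; [|exact (ln_strict_bernoulli _ _ Hc Hx)].
  apply ln_le.
  - assert (0 <= Cmod (z' - w')%C / m') by (apply Rdiv_le_0_compat; lra). lra.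
  - apply Rplus_le_compat_l.
    replace (K / q * (Cmod (z - w)%C / m)) with (K * Cmod (z - w)%C / (q * m))
      by (field; lra).
    unfold Rdiv. apply Rmult_le_compat; [exact Hd'| |exact Hlip|].
    + apply Rlt_le, Rinv_0_lt_compat. lra.
    + now apply Rinv_le_contravar.
Qed.

Theorem theorem8 (p : nat) (hp : (1 <= p)%nat) (a b : nat -> C) (f : C -> C)
  (hf : forall z : C, unit_disk z ->
     f z = sum_n_m (fun j => (a j * z ^ j + Cconj (b j) * Cconj z ^ j)%C) 1 p)
  (hharm : harmonic_mapping_on unit_disk f)
  (hmaps : forall z : C, unit_disk z -> unit_disk (f z)) :
  forall z w : C, unit_disk z -> unit_disk w -> z <> w ->
    j_metric unit_disk (f z) (f w)
      < INR p * sqrt (2 * INR p) / 2 * PI * j_metric unit_disk z w.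
Proof.
  intros z w Hz Hw Hne.
  assert (hF : forall u, unit_disk u -> f u = harmonic_poly p a b u) by exact hf.
  assert (Hbound : forall u, Cmod u <= 1 -> Cmod (harmonic_poly p a b u) <= 1).
  { apply harmonic_poly_bound_closed. intros u Hu.
    rewrite <- (hF u Hu). apply Rlt_le, (hmaps u Hu). }
  assert (Hschwarz : forall u, unit_disk u ->
    2 / PI * (1 - Cmod u) <= 1 - Cmod (f u)).
  { intros u Hu. rewrite (hF u Hu).
    pose proof (harmonic_poly_schwarz p a b u Hbound Hu). lra. }
  pose proof PI2_1 as Hpi.
  set (K := INR p * sqrt (2 * INR p)).
  assert (HK : 1 <= K).
  { assert (HP : 1 <= INR p) by (change 1 with (INR 1); now apply le_INR).
    assert (1 <= sqrt (2 * INR p)) by (rewrite <- sqrt_1; apply sqrt_le_1_alt; lra).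
    unfold K. nra. }
  replace (K / 2 * PI) with (K / (2 / PI)) by (field; lra).
  assert (Hq : 0 < 2 / PI) by (apply Rdiv_lt_0_compat; lra).
  assert (Hq1 : 2 / PI < 1) by (apply Rlt_div_l; lra).
  apply j_metric_unit_disk_lt; auto; [lra|].
  rewrite (hF z Hz), (hF w Hw).
  eapply Rle_trans.
  - apply harmonic_poly_lipschitz; now apply Rlt_le.
  - apply Rmult_le_compat_r; [apply Cmod_ge_0|].
    apply harmonic_lipschitz_constant_le; [exact hp|].
    now apply harmonic_poly_bessel.
Qed.
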